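(* Let $\mathbb k$ be a field of characteristic $0$ and let $(A_U,\mu)\xrightarrow{\ \phi\ }(A_W,\xi)\xleftarrow{\ \psi\ }(A_V,\nu)$ be a diagram of associative $\mathbb k$-algebras, i.e. $\mu,\nu,\xi$ are associative multiplications and $\phi,\psi$ are linear maps compatible with them. Let $\mathfrak g,\mathfrak a,P,M,\Phi,P_\Phi$ and the L$_\infty[1]$ algebra $(\widetilde{\mathfrak g}[1]\oplus\mathfrak a)^{P_\Phi}_M$ be as defined in the context, where $\widetilde{\mathfrak g}\subset\mathfrak g$ is the subalgebra with $$\widetilde{\mathfrak g}^n=\operatorname{Hom}(A_U^{\otimes n+1},A_U)\oplus\operatorname{Hom}(A_V^{\otimes n+1},A_V)\oplus\operatorname{Hom}(A_W^{\otimes n+1},A_W).$$ Let $\widetilde M=\widetilde\mu\oplus\widetilde\nu\oplus\widetilde\xi\in\widetilde{\mathfrak g}^1$ and $\widetilde\Phi=\widetilde\phi\oplus\widetilde\psi\in\mathfrak a^0$ be arbitrary. Then $$(A_U,\mu+\widetilde\mu)\xrightarrow{\ \phi+\widetilde\phi\ }(A_W,\xi+\widetilde\xi)\xleftarrow{\ \psi+\widetilde\psi\ }(A_V,\nu+\widetilde\nu)$$ is a diagram of associative algebras if and only if $$\widetilde M[1]\oplus\widetilde\Phi\in\operatorname{MC}\big((\widetilde{\mathfrak g}[1]\oplus\mathfrak a)^{P_\Phi}_M\big).$$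
   Context: All $\operatorname{Hom}$ and $\otimes$ are over $\mathbb k$; algebra morphisms are linear maps respecting the multiplications. The index set $\{U,V,W\}$ consists of three distinct symbols. Put $\mathfrak g=\prod_{n\ge 0}\mathfrak g^n$ and $\mathfrak a=\prod_{n\ge0}\mathfrak a^n$ with $$\mathfrak g^n=\bigoplus_{(T_0,\dots,T_n)\in\{U,V,W\}^{n+1}}\operatorname{Hom}(A_{T_0}\otimes\cdots\otimes A_{T_n},A_W)\ \oplus\ \operatorname{Hom}(A_U^{\otimes n+1},A_U)\ \oplus\ \operatorname{Hom}(A_V^{\otimes n+1},A_V),$$ $$\mathfrak a^n=\operatorname{Hom}(A_U^{\otimes n+1},A_W)\oplus\operatorname{Hom}(A_V^{\otimes n+1},A_W).$$ The space $\mathfrak a^n$ is a direct summand of $\mathfrak g^n$, and $P\colon\mathfrak g\to\mathfrak a$ is the projection given by this decomposition. Set $M=\mu\oplus\nu\oplus\xi\in\widetilde{\mathfrak g}^1$ and $\Phi=\phi\oplus\psi\in\mathfrak a^0$. Gerstenhaber bracket on $\mathfrak g$: for homogeneous multilinear maps $f$ (degree $m$, i.e. $m+1$ inputs) and $g$ (degree $n$, i.e. $n+1$ inputs), $f\circ_i g=f(\mathrm{id}^{\otimes i}\otimes g\otimes\mathrm{id}^{\otimes m-i})$ for $0\le i\le m$, understood to be $0$ if the target of $g$ is not the algebra that is the $i$-th input (counting from $0$) of $f$; $f\circ g=\sum_{i=0}^m(-1)^{ni}f\circ_i g$; and $[f,g]=f\circ g-(-1)^{mn}g\circ f$. This makes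 $\mathfrak g$ a graded Lie algebra with Abelian subalgebra $\mathfrak a$. $P_\Phi=P\circ\exp[\cdot,\Phi]\colon\mathfrak g\to\mathfrak a$, i.e. $P_\Phi(x)=P\big(x+[x,\Phi]+\tfrac12[[x,\Phi],\Phi]+\cdots\big)$ (a finite sum on each homogeneous $x$). Since $\phi,\psi$ are algebra morphisms, $P_\Phi(M)=0$. $(\widetilde{\mathfrak g}[1]\oplus\mathfrak a)^{P_\Phi}_M$ is the graded vector space $\widetilde{\mathfrak g}[1]\oplus\mathfrak a$ (where $x[1]$ has degree $|x|-1$ for $x\in\widetilde{\mathfrak g}$ homogeneous of degree $|x|$) with the L$_\infty[1]$ structure whose brackets are graded symmetric (with Koszul signs with respect to the degrees in $\widetilde{\mathfrak g}[1]\oplus\mathfrak a$), have zero $0$-ary bracket, and are given for homogeneous $x,y\in\widetilde{\mathfrak g}$, $a,a_1,\dots,a_n\in\mathfrak a$ by $$\langle x[1]\oplus a\rangle=-[M,x][1]\oplus P_\Phi(x+[M,a]),\qquad \langle x[1],y[1]\rangle=(-1)^{|x|}[x,y][1],$$ $$\langle x[1],a_1,\dots,a_n\rangle=P_\Phi[\dots[[x,a_1],a_2],\dots,a_n]\ (n\ge1),\qquad \langle a_1,\dots,a_n\rangle=P_\Phi[\dots[[M,a_1],a_2],\dots,a_n]\ (n\ge2),$$ all other brackets being zero up to permutation of the entries. For such an L$_\infty[1]$ algebra, $\operatorname{MC}$ denotes the set of degree $0$ elements $\alpha$ with $\sum_{n\ge1}\frac1{n!}\langle\alpha,\dots,\alpha\rangle=0$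 ($n$ copies of $\alpha$ in the $n$-th term). *)

(* Defs.v *)
From HB Require Import structures.
From mathcomp Require Import all_boot all_order all_algebra.
From mathcomp Require Import boolp classical_sets functions cardinality fsbigop.

Set Implicit Arguments.
Unset Strict Implicit.
Unset Printing Implicit Defensive.

Import GRing.Theory.
Local Open Scope ring_scope.

Inductive vertex : Set := U | V | W.

Definition vertex_code (c : vertex) : 'I_3 :=
  match c with U => inord 0 | V => inord 1 | W => inord 2 end.

Definition vertex_decode (i : 'I_3) : vertex :=
  match val i with 0%N => U | 1%N => V | _ => W end.

Lemma vertex_codeK : cancel vertex_code vertex_decode.
Proof. by case; rewrite /vertex_decode /= inordK. Qed.

HB.instance Definition _ := Finite.copy vertex (can_type vertex_codeK).

(* Diagrams of associative algebras.  Algebras are not assumed to be unital. *)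

Definition is_assoc_algebra (k : fieldType) (B : lmodType k)
    (m : B -> B -> B) : Prop :=
  bilinear_for *:%R *:%R m /\ associative m.

Definition is_algebra_morphism (k : fieldType) (B C : lmodType k)
    (m : B -> B -> B) (m' : C -> C -> C) (f : B -> C) : Prop :=
  linear f /\ {morph f : x y / m x y >-> m' x y}.

Definition is_algebra_diagram (k : fieldType) (A : vertex -> lmodType k)
    (mu : A U -> A U -> A U) (nu : A V -> A V -> A V) (xi : A W -> A W -> A W)
    (phi : A U -> A W) (psi : A V -> A W) : Prop :=
  [/\ is_assoc_algebra mu, is_assoc_algebra nu, is_assoc_algebra xi,
      is_algebra_morphism mu xi phi & is_algebra_morphism nu xi psi].

(* A decomposable tensor a_0 (x) ... (x) a_n with a_i in A_{T_i} is encoded as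
   the list of its factors, each one tagged with its vertex T_i.  A multilinear
   [f : cochain A] is then the same as the family, indexed by the nonempty
   words T = (T_0, ..., T_n) and the vertices S, of the linear maps
   A_{T_0} (x) ... (x) A_{T_n} -> A_S sending a_0 (x) ... (x) a_n to
   [f [:: a_0; ...; a_n] S].  Restricting [f] to lists of length n.+1 gives
   its component of degree n, so a cochain is an element of a product over all
   n >= 0. *)
Definition cochain (k : fieldType) (A : vertex -> lmodType k) : Type :=
  seq {c : vertex & A c} -> forall S : vertex, A S.

Section CochainModule.
Variables (k : fieldType) (A : vertex -> lmodType k).
Implicit Types f g h : cochain A.

HB.instance Definition _ := gen_eqMixin (cochain A).
HB.instance Definition _ := gen_choiceMixin (cochain A).

Definition cochain0 : cochain A := fun _ _ => 0.
Definition cochain_opp f : cochain A := fun s S => - f s S.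
Definition cochain_add f g : cochain A := fun s S => f s S + g s S.
Definition cochain_scale (c : k) f : cochain A := fun s S => c *: f s S.

Lemma cochainP f g : (forall s S, f s S = g s S) -> f = g.
Proof.
move=> fg; apply: functional_extensionality_dep => s.
by apply: functional_extensionality_dep => S.
Qed.

Lemma cochain_addA : associative cochain_add.
Proof. by move=> f g h; apply: cochainP => s S; apply: addrA. Qed.
Lemma cochain_addC : commutative cochain_add.
Proof. by move=> f g; apply: cochainP => s S; apply: addrC. Qed.
Lemma cochain_add0 : left_id cochain0 cochain_add.
Proof. by move=> f; apply: cochainP => s S; apply: add0r. Qed.
Lemma cochain_addN : left_inverse cochain0 cochain_opp cochain_add.
Proof. by move=> f; apply: cochainP => s S; apply: addNr. Qed.

HB.instance Definition _ := GRing.isZmodule.Build (cochain A)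
  cochain_addA cochain_addC cochain_add0 cochain_addN.

Lemma cochain_scaleA c d f :
  cochain_scale c (cochain_scale d f) = cochain_scale (c * d) f.
Proof. by apply: cochainP => s S; apply: scalerA. Qed.
Lemma cochain_scale1 : left_id 1 cochain_scale.
Proof. by move=> f; apply: cochainP => s S; apply: scale1r. Qed.
Lemma cochain_scaleDr : right_distributive cochain_scale +%R.
Proof. by move=> c f g; apply: cochainP => s S; apply: scalerDr. Qed.
Lemma cochain_scaleDl f : {morph cochain_scale^~ f : c d / c + d}.
Proof. by move=> c d; apply: cochainP => s S; apply: scalerDl. Qed.

HB.instance Definition _ := GRing.Zmodule_isLmodule.Build k (cochain A)
  cochain_scaleA cochain_scale1 cochain_scaleDr cochain_scaleDl.

End CochainModule.

Section Gerstenhaber.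
Variables (k : fieldType) (A : vertex -> lmodType k).
Implicit Types (f g x : cochain A) (s : seq {c : vertex & A c}).

Definition multilinear f : Prop :=
  forall p q c S, linear (fun a : A c => f (p ++ Tagged A a :: q) S).

Definition word s : seq vertex := [seq tag a | a <- s].

(* The summands Hom(A_{T_0} (x) ... (x) A_{T_n}, A_S) occurring in each of the
   three spaces, T being the word T_0 ... T_n. *)
Definition g_summand (T : seq vertex) (S : vertex) : bool :=
  (T != [::]) && ((S == W) || all (pred1 S) T).
Definition gt_summand (T : seq vertex) (S : vertex) : bool :=
  (T != [::]) && all (pred1 S) T.
Definition a_summand (T : seq vertex) (S : vertex) : bool :=
  [&& T != [::], S == W & all (pred1 U) T || all (pred1 V) T].

Definition cochain_space (summand : seq vertex -> vertex -> bool) :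
    set (cochain A) :=
  [set f | multilinear f /\ forall s S, ~~ summand (word s) S -> f s S = 0]%classic.

Definition g_space := cochain_space g_summand.
Definition gt_space := cochain_space gt_summand.
Definition a_space := cochain_space a_summand.

Definition of_degree (d : int) : set (cochain A) :=
  [set f | forall s, (size s)%:Z != d + 1 -> f s = (0 : cochain A) s]%classic.

Definition P f : cochain A :=
  fun s S => if a_summand (word s) S then f s S else 0.

(* f o_i g for g of degree n.  The sum over R retains, for each component of
   g, only those components of f whose i-th input is the target of g. *)
Definition insertion (n i : nat) f g : cochain A := fun s S =>
  \sum_(R : vertex)
    f (take i s ++ Tagged A (g (take n.+1 (drop i s)) R) :: drop (i + n.+1) s) S.

(* f o g for f of degree m and g of degree n. *)
Definition circ (m n : nat) f g : cochain A :=
  \sum_(i < m.+1) (-1) ^+ (n * i) *: insertion n i f g.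

(* The Gerstenhaber bracket of two elements of the product over all degrees.
   On a list of length m + n + 1, [circ m n f g] only involves the component
   of degree m of f and that of degree n of g. *)
Definition bracket f g : cochain A := fun s S =>
  \sum_(m < size s) let n := ((size s).-1 - m)%N in
    (circ m n f g - (-1) ^+ (m * n) *: circ n m g f) s S.

(* exp [., Phi] x.  For Phi of degree 0 each component of the series, i.e.
   its value on each list s, only depends on the component of x of degree
   (size s).-1 and is a sum with finitely many nonzero terms: [., Phi] raises
   by 1 the number of inputs outside W, or moves the target from U or V to W. *)
Definition exp_bracket (Phi x : cochain A) : cochain A := fun s S =>
  (\sum_(j \in [set: nat]%classic)
     (j`!%:R)^-1 *: iter j (fun y => bracket y Phi) x s S)%R.

Definition P_exp (Phi x : cochain A) : cochain A := P (exp_bracket Phi x).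

(* mu (+) nu (+) xi, an element of degree 1. *)
Definition mult_cochain (mu : A U -> A U -> A U) (nu : A V -> A V -> A V)
    (xi : A W -> A W -> A W) : cochain A := fun s S =>
  match s, S with
  | [:: existT U a; existT U b], U => mu a b
  | [:: existT V a; existT V b], V => nu a b
  | [:: existT W a; existT W b], W => xi a b
  | _, _ => 0
  end.

(* phi (+) psi, an element of degree 0. *)
Definition map_cochain (phi : A U -> A W) (psi : A V -> A W) : cochain A :=
  fun s S =>
  match s, S with
  | [:: existT U a], W => phi a
  | [:: existT V a], W => psi a
  | _, _ => 0
  end.

End Gerstenhaber.

(* A graded vector space with multibrackets: [lb_degree d] is the piece of
   degree d, as a subspace of an ambient space.  The n-ary bracket is applied
   to a list of n pairs (d_j, z_j), where z_j is homogeneous of degree d_j;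
   the degrees d_j only enter through the Koszul signs. *)
Record multibracket (k : fieldType) := Multibracket {
  lb_space : lmodType k;
  lb_degree : int -> set lb_space;
  lb_bracket : seq (int * lb_space) -> lb_space
}.

Definition MC_term (k : fieldType) (L : multibracket k) (z : lb_space L)
    (n : nat) : lb_space L :=
  (n`!%:R)^-1 *: lb_bracket (nseq n (0, z)).

(* The sum is required to be finite: [\sum_(n \in D) F n] is 0 by convention
   when F has infinite support in D. *)
Definition MC (k : fieldType) (L : multibracket k) : set (lb_space L) :=
  [set z | [/\ lb_degree 0 z,
               finite_set [set n | (0 < n)%N /\ MC_term z n != 0]
             & \sum_(n \in [set n | (0 < n)%N]) MC_term z n = 0]]%classic.

Section LInfinity.
Variables (k : fieldType) (A : vertex -> lmodType k).
Variables M Phi : cochain A.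

(* A pair (x, a) stands for x[1] (+) a. *)
Let space : Type := (cochain A * cochain A)%type.

Definition linf_degree (d : int) : set space :=
  [set z | (gt_space z.1 /\ of_degree (d + 1) z.1) /\
           (a_space z.2 /\ of_degree d z.2)]%classic.

Definition unary_bracket (z : space) : space :=
  (- bracket M z.1, P_exp Phi (z.1 + bracket M z.2)).

(* <x[1], y[1]> for x[1] of degree d, i.e. |x| = d + 1. *)
Definition binary_gt (d : int) (x y : cochain A) : cochain A :=
  (-1) ^ (d + 1) *: bracket x y.

(* <x[1], a_1, ..., a_n> and, for x = M, <a_1, ..., a_n>. *)
Definition derived_bracket (x : cochain A) (az : seq (cochain A)) : cochain A :=
  P_exp Phi (foldl (@bracket k A) x az).

(* The multilinear expansion of <z_1, ..., z_n> for z_j = x_j[1] (+) a_j.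
   Graded symmetry moves x_j[1] to the front past a_1, ..., a_{j-1}, which
   have degrees d_1, ..., d_{j-1}. *)
Definition linf_bracket (zs : seq (int * space)) : space :=
  let ds := [seq z.1 | z <- zs] in
  let xs := [seq z.2.1 | z <- zs] in
  let az := [seq z.2.2 | z <- zs] in
  match zs with
  | [::] => 0
  | [:: z] => unary_bracket z.2
  | _ =>
    (if zs is [:: z1; z2] then binary_gt z1.1 z1.2.1 z2.2.1 else 0,
     \sum_(j < size zs)
        (-1) ^ (ds`_j * \sum_(d <- take j ds) d) *:
          derived_bracket xs`_j (take j az ++ drop j.+1 az)
     + derived_bracket M az)
  end.

Definition linf : multibracket k :=
  @Multibracket k (cochain A * cochain A)%type linf_degree linf_bracket.

End LInfinity.

(* Main.v *)
(** Since [Phi'] and [Phi] take their values in [A W] and vanish on [A W], the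
    derivation [[., Phi']] has zero third power on bilinear cochains and
    commutes with [[., Phi]].  Only the terms of arity 1, 2 and 3 of the
    Maurer-Cartan sum of [M'[1] (+) Phi'] survive, and the sum is the pair of
    [- 1/2 [M + M', M + M']] (using [[M, M] = 0]) and
    [P_exp (Phi + Phi') (M + M') - P_exp Phi M].  The first component vanishes
    iff [M + M'] is associative.  On [(a, b)] in [A_U] or [A_V] the second one
    measures the failure of [Phi + Phi'] to be multiplicative, because
    [P_exp Phi M (a, b) = xi (Phi a, Phi b) - Phi (M (a, b))]. *)
Require Import Defs.
From HB Require Import structures.
From mathcomp Require Import all_boot all_order all_algebra.
From mathcomp Require Import boolp classical_sets functions cardinality fsbigop.
From mathcomp Require Import zify.

Set Implicit Arguments.
Unset Strict Implicit.
Unset Printing Implicit Defensive.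

Import GRing.Theory.
Local Open Scope ring_scope.

Lemma linear_eq0 (k : fieldType) (B C : lmodType k) (f : B -> C) :
  linear f -> f 0 = 0.
Proof. by move=> fL; have := fL (-1) 0 0; rewrite !scaleN1r oppr0 addr0 addNr. Qed.

Lemma linearPD (k : fieldType) (B C : lmodType k) (f : B -> C) :
  linear f -> {morph f : x y / x + y}.
Proof. by move=> fL x y; have := fL 1 x y; rewrite !scale1r. Qed.

Lemma foldl_nseq (T R : Type) (op : T -> R -> T) z0 r n :
  foldl op z0 (nseq n r) = iter n (op^~ r) z0.
Proof. by elim: n z0 => //= n IHn z0; rewrite IHn -iterSr. Qed.

(** * Degrees and low-arity formulas for the Gerstenhaber bracket *)

Section Cochains.
Variables (k : fieldType) (A : vertex -> lmodType k).
Implicit Types (f g x y z Phi : cochain A) (s : seq {c : vertex & A c}).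

Lemma cochainDE f g s S : (f + g) s S = f s S + g s S. Proof. by []. Qed.
Lemma cochainNE f s S : (- f) s S = - f s S. Proof. by []. Qed.
Lemma cochainZE (c : k) f s S : (c *: f) s S = c *: f s S. Proof. by []. Qed.
Lemma cochain0E s S : (0 : cochain A) s S = 0. Proof. by []. Qed.
Definition cochainE := (cochainDE, cochainNE, cochainZE, cochain0E).

Lemma cochain_sumE I (r : seq I) (Q : pred I) (F : I -> cochain A) s S :
  (\sum_(i <- r | Q i) F i) s S = \sum_(i <- r | Q i) F i s S.
Proof.
by apply: (big_morph (fun f : cochain A => f s S)).
Qed.

Lemma multilinear0 f p q c S :
  multilinear f -> f (p ++ Tagged A (0 : A c) :: q) S = 0.
Proof. by move=> fL; apply: (linear_eq0 (fL p q c S)). Qed.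

Lemma of_degreeP (n : nat) f :
  of_degree n%:Z f <-> forall s S, size s != n.+1 -> f s S = 0.
Proof.
split=> [fn s S sn|fn s sn]; first by rewrite fn //; lia.
by apply: functional_extensionality_dep => S; rewrite fn //; lia.
Qed.

Section Bracket.
Variables (p q : nat) (f g : cochain A).
Hypotheses (fL : multilinear f) (gL : multilinear g).
Hypotheses (fp : of_degree p%:Z f) (gq : of_degree q%:Z g).

(** An insertion feeds [n.+1] factors to [g] and leaves [m.+1] to [f]. If [m != p], then [f] sees a
    wrong arity; otherwise [n != q], so [g] returns 0 and multilinearity of [f] kills the term. *)
Lemma circ_eq0 m n s S :
  size s = (m + n).+1 -> (m != p) || (n != q) -> circ m n f g s S = 0.
Proof.
move=> sz mn; rewrite /circ cochain_sumE big1 // => i _; have lt_im := ltn_ord i.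
rewrite cochainZE /insertion big1 ?scaler0 // => R _.
have [/eqP mp|mp] := boolP (m == p); last first.
  move/of_degreeP: fp => -> //; rewrite size_cat /= size_takel ?size_drop; lia.
rewrite (_ : g _ R = 0) ?multilinear0 //.
move/of_degreeP: gq => -> //; rewrite size_takel ?size_drop; lia.
Qed.

End Bracket.

Lemma bracket_of_degree p q f g :
    multilinear f -> multilinear g -> of_degree p%:Z f -> of_degree q%:Z g ->
  of_degree (p + q)%N%:Z (bracket f g).
Proof.
move=> fL gL fp gq; apply/of_degreeP => s S sz.
rewrite /bracket big1 // => m _; have lt_ms := ltn_ord m; rewrite !cochainE.
rewrite (circ_eq0 fL fp gq) ?(circ_eq0 gL gq fp); try lia.
by rewrite scaler0 subrr.
Qed.

(** Both compositions in the [m]-th summand vanish unless [m = p], since the complementary degree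
    [(size s).-1 - m] is [q] exactly for that [m]. *)
Lemma bracketE p q f g s S :
    multilinear f -> multilinear g -> of_degree p%:Z f -> of_degree q%:Z g ->
    size s = (p + q).+1 ->
  bracket f g s S = circ p q f g s S - (-1) ^+ (p * q) *: circ q p g f s S.
Proof.
move=> fL gL fp gq sz; have ps : (p < size s)%N by lia.
rewrite /bracket (bigD1 (Ordinal ps)) //= [X in _ + X]big1 ?addr0.
  by have -> : ((size s).-1 - p = q)%N by lia.
move=> m; rewrite -val_eqE /= => mp; have lt_ms := ltn_ord m; rewrite !cochainE.
rewrite (circ_eq0 fL fp gq) ?(circ_eq0 gL gq fp); try lia.
by rewrite scaler0 subrr.
Qed.

Lemma circ10E f g (a b : {c : vertex & A c}) S :
  circ 1 0 f g [:: a; b] S =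
    \sum_R (f [:: Tagged A (g [:: a] R); b] S +
            f [:: a; Tagged A (g [:: b] R)] S).
Proof.
by rewrite /circ !big_ord_recl big_ord0 !cochainE addr0 !scale1r -big_split.
Qed.

Lemma circ01E f g (a b : {c : vertex & A c}) S :
  circ 0 1 f g [:: a; b] S = \sum_R f [:: Tagged A (g [:: a; b] R)] S.
Proof. by rewrite /circ big_ord1 !cochainE scale1r. Qed.

Lemma circ11E f g (a b c : {c : vertex & A c}) S :
  circ 1 1 f g [:: a; b; c] S =
    \sum_R (f [:: Tagged A (g [:: a; b] R); c] S -
            f [:: a; Tagged A (g [:: b; c] R)] S).
Proof.
by rewrite /circ !big_ord_recl big_ord0 !cochainE addr0 expr0 expr1 scaleN1r scale1r
  big_split sumrN.
Qed.

(** * Bilinear cochains and arrows *)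

Lemma multilinear_degree0 f :
    of_degree 0 f -> (forall c S, linear (fun a : A c => f [:: Tagged A a] S)) ->
  multilinear f.
Proof.
move=> f0 fL [|a p] [|b q] c S; first exact: fL.
all: by move=> t u v /=; rewrite !((of_degreeP 0 f).1 f0) /= ?size_cat /=;
  rewrite ?scaler0 ?addr0 //; lia.
Qed.

Lemma multilinear_degree1 f :
    of_degree 1 f ->
    (forall c b S, linear (fun a : A c => f [:: Tagged A a; b] S)) ->
    (forall c a S, linear (fun b : A c => f [:: a; Tagged A b] S)) ->
  multilinear f.
Proof.
move=> f1 fLl fLr [|a [|a' p]] [|b [|b' q]] c S //; do ?[exact: fLl|exact: fLr].
all: by move=> t u v /=; rewrite !((of_degreeP 1 f).1 f1) /= ?size_cat /=;
  rewrite ?scaler0 ?addr0 //; lia.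
Qed.

(** Larger than the degree 1 part of [gt_space]: bracketing with an arrow creates components from
    mixed words to [A W], and the class has to be stable under this operation. *)
Definition quadratic f := g_space f /\ of_degree 1 f.
Definition linear_arrow f := a_space f /\ of_degree 0 f.

Lemma quadratic_gt f : gt_space f -> of_degree 1 f -> quadratic f.
Proof.
move=> [fL f0] f1; do 2!split=> //; move=> s S sS; apply: f0; apply: contra sS.
by rewrite /gt_summand /g_summand => /andP[-> ->]; rewrite orbT.
Qed.

Lemma gt_pair_eq0 f (a b : {c : vertex & A c}) S :
  gt_space f -> ~~ ((tag a == S) && (tag b == S)) -> f [:: a; b] S = 0.
Proof.
by case=> _ f0 abS; apply: f0; rewrite /gt_summand /= andbT.
Qed.

Lemma quadratic_pair_eq0 f (a b : {c : vertex & A c}) S :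
    quadratic f -> S != W -> ~~ ((tag a == S) && (tag b == S)) ->
  f [:: a; b] S = 0.
Proof.
by move=> [[_ f0] _] SW abS; apply: f0; rewrite /g_summand /= (negbTE SW) andbT.
Qed.

Lemma quadratic_add f g : quadratic f -> quadratic g -> quadratic (f + g).
Proof.
move=> [[fL f0] f1] [[gL g0] g1]; split; first split.
- by move=> p q c S t u v; rewrite !cochainE fL gL scalerDr addrACA.
- by move=> s S sS; rewrite cochainE f0 // g0 // addr0.
apply/of_degreeP => s S sS.
by rewrite cochainE (of_degreeP 1 f).1 ?(of_degreeP 1 g).1 // addr0.
Qed.

Lemma quadratic0 : quadratic 0.
Proof.
by split; first split=> [p q c S t u v|s S _]; rewrite ?cochainE ?scaler0 ?addr0.
Qed.

Lemma arrow_target Phi s S : linear_arrow Phi -> S != W -> Phi s S = 0.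
Proof.
by move=> [[_ Phi0] _] SW; apply: Phi0; rewrite /a_summand (negbTE SW) andbF.
Qed.

Lemma arrow_W Phi (a : A W) S : linear_arrow Phi -> Phi [:: Tagged A a] S = 0.
Proof.
move=> [[_ Phi0] _]; apply: Phi0; rewrite /a_summand /= !andbT.
by rewrite (introF eqP (_ : W <> U)) // (introF eqP (_ : W <> V)) // andbF.
Qed.

(** The result is tagged [W] whatever the tag of [a]; for an arrow [Phi] and a factor already in
    [A W] it is the zero vector. *)
Definition push Phi (a : {c : vertex & A c}) : {c : vertex & A c} :=
  Tagged A (Phi [:: a] W).

(** * The derivation given by an arrow, and its exponential *)

Section Derivation.
Variable Phi : cochain A.
Hypothesis PhiA : linear_arrow Phi.
Let PhiL : multilinear Phi := PhiA.1.1.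
Local Notation D := (fun y => bracket y Phi).

Lemma push_push Psi (a : {c : vertex & A c}) :
  push Phi (push Psi a) = Tagged A (0 : A W).
Proof. by rewrite /push arrow_W. Qed.

Lemma sum_over_W (F : vertex -> A W) :
  (forall R, R != W -> F R = 0) -> \sum_R F R = F W.
Proof. by move=> F0; rewrite (bigD1 W) //= big1 ?addr0. Qed.

(** [Phi] outputs only in [A W]. Applied after [y] it has target [W]; inserted into [y] it creates
    an input in [A W], which the components of [y] with target [S != W] do not accept. *)
Lemma bracket_arrow_target y s S : quadratic y -> S != W -> D y s S = 0.
Proof.
move=> yQ SW; have [[yL y0] y1] := yQ.
have [|sz] := eqVneq (size s) 2; last first.
  by apply: ((of_degreeP _ _).1 (bracket_of_degree yL PhiL y1 PhiA.2)).
case: s => [|a [|b []]] // _.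
rewrite (bracketE _ yL PhiL y1 PhiA.2) //= mul1n expr0 scale1r circ10E circ01E.
rewrite !big1 ?subr0 // => R _; first by rewrite arrow_target.
have [->|RW] := eqVneq R W.
  by rewrite !quadratic_pair_eq0 ?addr0 //= negb_and (eq_sym W) SW ?orbT.
rewrite !(arrow_target _ PhiA RW) (multilinear0 [::] [:: b]) //.
by rewrite (multilinear0 [:: a] [::]) // addr0.
Qed.

Lemma bracket_arrow_pair y (a b : {c : vertex & A c}) : quadratic y ->
  D y [:: a; b] W = y [:: push Phi a; b] W + y [:: a; push Phi b] W
                  - \sum_R Phi [:: Tagged A (y [:: a; b] R)] W.
Proof.
move=> yQ; have [[yL y0] y1] := yQ.
rewrite (bracketE _ yL PhiL y1 PhiA.2) //= mul1n expr0 scale1r circ10E circ01E.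
congr (_ - _); rewrite big_split; congr (_ + _); apply: sum_over_W => R RW;
  rewrite (arrow_target _ PhiA RW).
  exact: (multilinear0 [::] [:: b]).
exact: (multilinear0 [:: a] [::]).
Qed.

Lemma quadratic_bracket y : quadratic y -> quadratic (D y).
Proof.
move=> yQ; have [[yL y0] y1] := yQ.
have Dy1 : of_degree 1 (D y) := bracket_of_degree yL PhiL y1 PhiA.2.
have yLl b c S : linear (fun a : A c => y [:: Tagged A a; b] S).
  exact: (yL [::] [:: b]).
have yLr a c S : linear (fun b : A c => y [:: a; Tagged A b] S).
  exact: (yL [:: a] [::]).
have PL c S : linear (fun a : A c => Phi [:: Tagged A a] S) by exact: (PhiL [::] [::]).
(* Each of the three terms of [bracket_arrow_pair] is linear in the varied factor; [DL] collects
   them. *)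
have DL (t : k) (a1 a2 a3 b1 b2 b3 : A W) :
    (t *: a1 + b1) + (t *: a2 + b2) - (t *: a3 + b3) =
    t *: (a1 + a2 - a3) + (b1 + b2 - b3).
  by rewrite [t *: a1 + b1 + _]addrACA opprD [LHS]addrACA !scalerDr scalerN.
split=> //; split.
- apply: multilinear_degree1 => // c d S t u v.
  + have [->|SW] := eqVneq S W; last by rewrite !bracket_arrow_target // scaler0 addr0.
    rewrite !bracket_arrow_pair // /push PL !yLl -DL; congr (_ - _).
    by rewrite scaler_sumr -big_split; apply: eq_bigr => R _; rewrite yLl PL.
  + have [->|SW] := eqVneq S W; last by rewrite !bracket_arrow_target // scaler0 addr0.
    rewrite !bracket_arrow_pair // /push PL !yLr -DL; congr (_ - _).
    by rewrite scaler_sumr -big_split; apply: eq_bigr => R _; rewrite yLr PL.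
(* On a nonempty word, failing [g_summand] forces [S != W]. *)
move=> [|a s] S; first by rewrite (of_degreeP 1 _).1.
rewrite /g_summand /= negb_or => /andP[SW _]; exact: bracket_arrow_target.
Qed.

(** An input from [A W] forces the output of [y] into [A W], where [Phi] vanishes. *)
Lemma arrow_output_eq0 y (a b : {c : vertex & A c}) :
    quadratic y -> (tag a == W) || (tag b == W) ->
  \sum_R Phi [:: Tagged A (y [:: a; b] R)] W = 0.
Proof.
move=> yQ abW; rewrite sum_over_W ?arrow_W // => R RW.
rewrite quadratic_pair_eq0 ?(multilinear0 [::] [::]) //.
apply/negP => /andP[/eqP aR /eqP bR].
by move: abW; rewrite aR bR (negbTE RW).
Qed.

Lemma arrow_output_pair y c (a b : A c) (u := Tagged A a) (v := Tagged A b) :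
    quadratic y ->
  \sum_R Phi [:: Tagged A (y [:: u; v] R)] W = Phi [:: Tagged A (y [:: u; v] c)] W.
Proof.
move=> yQ; rewrite (bigD1 c) //= big1 ?addr0 // => R Rc.
have [->|RW] := eqVneq R W; first by rewrite arrow_W.
rewrite quadratic_pair_eq0 ?(multilinear0 [::] [::]) //=.
by rewrite eq_sym (negbTE Rc).
Qed.

Lemma arrow_output_bracket y s : quadratic y ->
  \sum_R Phi [:: Tagged A (D y s R)] W = 0.
Proof.
move=> yQ; rewrite sum_over_W ?arrow_W // => R RW.
by rewrite bracket_arrow_target // (multilinear0 [::] [::]).
Qed.

(** Pushing the same factor twice gives 0, and a term combining [Phi] on the output with another
    [Phi] vanishes because that output lies in [A W] or the result does. What remains is one push on
    each factor, reached in two orders. *)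
Lemma bracket2_pair y (a b : {c : vertex & A c}) : quadratic y ->
  D (D y) [:: a; b] W = y [:: push Phi a; push Phi b] W *+ 2.
Proof.
move=> yQ; have [[yL y0] y1] := yQ.
have DyQ := quadratic_bracket yQ.
rewrite bracket_arrow_pair // arrow_output_bracket // subr0 !bracket_arrow_pair //.
rewrite !arrow_output_eq0 ?eqxx ?orbT // !push_push !subr0.
by rewrite (multilinear0 [::] [:: b]) // (multilinear0 [:: a] [::]) // add0r addr0.
Qed.

(** Three pushes on two factors hit one factor twice. *)
Lemma bracket3_eq0 y : quadratic y -> D (D (D y)) = 0.
Proof.
move=> yQ; have [[yL _] _] := yQ.
have DyQ := quadratic_bracket yQ; have DDyQ := quadratic_bracket DyQ.
have [[DDyL _] DDy1] := DDyQ.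
apply: cochainP => s S; have [->|SW] := eqVneq S W; last exact: bracket_arrow_target.
have [|sz] := eqVneq (size s) 2; last first.
  by apply: ((of_degreeP _ _).1 (bracket_of_degree DDyL PhiL DDy1 PhiA.2)).
case: s => [|a [|b []]] // _.
rewrite bracket_arrow_pair // arrow_output_bracket // !bracket2_pair // !push_push.
rewrite (multilinear0 [::] [:: push Phi b]) // (multilinear0 [:: push Phi a] [::]) //.
by rewrite mul0rn subr0 addr0.
Qed.

Lemma bracket_arrow_add y z : quadratic y -> quadratic z -> D (y + z) = D y + D z.
Proof.
move=> yQ zQ; have yzQ := quadratic_add yQ zQ.
apply: cochainP => s S; rewrite cochainE.
have [->|SW] := eqVneq S W; last by rewrite !bracket_arrow_target // addr0.
have Ddeg x : quadratic x -> of_degree 1 (D x) by case/quadratic_bracket.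
have [|sz] := eqVneq (size s) 2; last first.
  by rewrite !((of_degreeP 1 _).1 (Ddeg _ _)) // addr0.
case: s => [|a [|b []]] // _; rewrite !bracket_arrow_pair // !cochainE.
rewrite [LHS](_ : _ = (y [:: push Phi a; b] W + z [:: push Phi a; b] W)
  + (y [:: a; push Phi b] W + z [:: a; push Phi b] W)
  - (\sum_R Phi [:: Tagged A (y [:: a; b] R)] W
     + \sum_R Phi [:: Tagged A (z [:: a; b] R)] W)); last first.
  congr (_ - _); rewrite -big_split; apply: eq_bigr => R _.
  exact: (linearPD (@PhiL [::] [::] R W) (y _ R) (z _ R)).
by rewrite [X in X - _ = _]addrACA opprD [LHS]addrACA.
Qed.

Lemma iter_bracket_eq0 y n : quadratic y -> (2 < n)%N -> iter n D y = 0.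
Proof.
move=> yQ; have D0 : D 0 = 0.
  have := bracket_arrow_add quadratic0 quadratic0; rewrite addr0 => D00.
  by apply: (addrI (bracket 0 Phi)); rewrite addr0 -D00.
case: n => [|[|[|n]]] // _; elim: n => [|n IHn]; first exact: bracket3_eq0.
by rewrite iterS IHn.
Qed.

Hypothesis char_k : [pchar k] =i pred0.

Lemma exp_bracketE y s S : quadratic y ->
  exp_bracket Phi y s S = y s S + D y s S + 2%:R^-1 *: D (D y) s S.
Proof.
(* Nilpotency cuts the sum over all [j] down to [j < 3]. *)
move=> yQ; rewrite /exp_bracket -(fsbig_widen `I_3) //; last first.
  move=> j [_ /negP]; rewrite /= -leqNgt => j2.
  by rewrite /= iter_bracket_eq0 // cochainE scaler0.
by rewrite -fsbig_ord !big_ord_recl big_ord0 /= addr0 invr1 !scale1r addrA.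
Qed.

Lemma P_exp_eq0 y s S : ~~ a_summand (word s) S -> P_exp Phi y s S = 0.
Proof. by rewrite /P_exp /P => /negbTE->. Qed.

Lemma P_exp_target y s S : S != W -> P_exp Phi y s S = 0.
Proof. by move=> SW; rewrite P_exp_eq0 // /a_summand (negbTE SW) andbF. Qed.

Lemma P_exp_size y s S : quadratic y -> size s != 2 -> P_exp Phi y s S = 0.
Proof.
move=> yQ sz; rewrite /P_exp /P; case: ifP => // _; rewrite exp_bracketE //.
have DyQ := quadratic_bracket yQ; have DDyQ := quadratic_bracket DyQ.
rewrite ((of_degreeP 1 _).1 yQ.2) // ((of_degreeP 1 _).1 DyQ.2) //.
by rewrite ((of_degreeP 1 _).1 DDyQ.2) // scaler0 !addr0.
Qed.

(** The factor 2 of [bracket2_pair] cancels the coefficient 1/2!. With formal sums the result reads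
    y (u + Phi u, v + Phi v) - Phi (y (u, v)). *)
Lemma P_exp_pair y c (a b : A c) (u := Tagged A a) (v := Tagged A b) :
    quadratic y -> c != W ->
  P_exp Phi y [:: u; v] W =
    y [:: u; v] W + y [:: push Phi u; v] W + y [:: u; push Phi v] W
    + y [:: push Phi u; push Phi v] W
    - Phi [:: Tagged A (y [:: u; v] c)] W.
Proof.
move=> yQ cW; have DyQ := quadratic_bracket yQ.
have two_neq0 : 2%:R != 0 :> k.
  by rewrite (pcharf0P k).1.
rewrite /P_exp /P ifT; last first.
  by rewrite /a_summand /= eqxx !andbT /= !andbb; case: (c) cW; rewrite ?eqxx ?orbT.
rewrite exp_bracketE // bracket2_pair // -scaler_nat scalerA mulVf // scale1r.
rewrite bracket_arrow_pair // arrow_output_pair //.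
by rewrite !addrA [LHS]addrAC.
Qed.

Lemma P_exp_add y z : quadratic y -> quadratic z ->
  P_exp Phi (y + z) = P_exp Phi y + P_exp Phi z.
Proof.
move=> yQ zQ; apply: cochainP => s S; rewrite cochainE /P_exp /P.
case: ifP => _; last by rewrite addr0.
have DyQ := quadratic_bracket yQ; have DzQ := quadratic_bracket zQ.
rewrite !exp_bracketE //; last exact: quadratic_add.
rewrite !bracket_arrow_add // !cochainE scalerDr.
by rewrite [X in X + _ = _]addrACA [LHS]addrACA.
Qed.

End Derivation.

(** Reduces identities between values of [P_exp] to pairs of factors from the same [A U] or [A V]:
    the projection [P] rules out all other words and targets, the degree all other lengths. *)
Lemma P_exp_support s S :
  (forall Phi y, linear_arrow Phi -> quadratic y -> P_exp Phi y s S = 0) \/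
  exists c (a b : A c), [/\ c != W, S = W & s = [:: Tagged A a; Tagged A b]].
Proof.
have [SW|SW] := eqVneq S W; last by left=> *; apply: P_exp_target.
have [|sz] := eqVneq (size s) 2; last by left=> *; apply: P_exp_size.
case: s => [|[c a] [|[d b] []]] // _.
have [cdW|cdW] := boolP (a_summand [:: c; d] S); last by left=> *; apply: P_exp_eq0.
have [dc cW] : d = c /\ c != W.
  by move: cdW; rewrite SW /a_summand /= eqxx !andbT => /orP[]/andP[/eqP-> /eqP->];
     split=> //; apply/eqP.
by right; subst d; exists c, a, b.
Qed.

Lemma linear_arrow_add Phi Psi :
  linear_arrow Phi -> linear_arrow Psi -> linear_arrow (Phi + Psi).
Proof.
move=> [[fL f0] f1] [[gL g0] g1]; split; first split.
- by move=> p q c S t u v; rewrite !cochainE fL gL scalerDr addrACA.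
- by move=> s S sS; rewrite cochainE f0 // g0 // addr0.
apply/of_degreeP => s S sS.
by rewrite cochainE ((of_degreeP 0 Phi).1 f1) ?((of_degreeP 0 Psi).1 g1) // addr0.
Qed.

(** * Changing the arrow from [Phi] to [Phi + Psi] *)

Section Twist.
Variables Phi Psi : cochain A.
Hypotheses (PhiA : linear_arrow Phi) (PsiA : linear_arrow Psi).
Hypothesis char_k : [pchar k] =i pred0.
Variable y : cochain A.
Hypotheses (ygt : gt_space y) (y1 : of_degree 1 y).
Let yQ := quadratic_gt ygt y1.
Let yL : multilinear y := ygt.1.
Variables (c : vertex) (a b : A c).
Hypothesis cW : c != W.
Local Notation u := (Tagged A a).
Local Notation v := (Tagged A b).

(** Pushing only one factor gives a word with letters [W] and [c != W], on which a cochain of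
    [gt_space] vanishes. *)
Let y_pushl Xi S : y [:: push Xi u; v] S = 0.
Proof.
apply: gt_pair_eq0 => //=; apply: contra cW => /andP[/eqP-> /eqP->]; exact: eqxx.
Qed.

Let y_pushr Xi S : y [:: u; push Xi v] S = 0.
Proof.
apply: gt_pair_eq0 => //=; apply: contra cW => /andP[/eqP-> /eqP->]; exact: eqxx.
Qed.

Let y_0l d q S : y [:: Tagged A (0 : A d); q] S = 0.
Proof. exact: (multilinear0 [::] [:: q]). Qed.

Let y_0r d q S : y [:: q; Tagged A (0 : A d)] S = 0.
Proof. exact: (multilinear0 [:: q] [::]). Qed.

Lemma P_exp_gt Xi : linear_arrow Xi ->
  P_exp Xi y [:: u; v] W =
    y [:: push Xi u; push Xi v] W - Xi [:: Tagged A (y [:: u; v] c)] W.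
Proof.
move=> XiA; rewrite P_exp_pair // (gt_pair_eq0 ygt) ?(negbTE cW) //= ?(negbTE cW) //.
by rewrite y_pushl y_pushr !add0r.
Qed.

(** This is the part of first order in [Psi] of [P_exp_gt] at [Phi + Psi]: one factor is pushed by
    each arrow, or [Psi] acts on the output. *)
Lemma P_exp_bracket_gt :
  P_exp Phi (bracket y Psi) [:: u; v] W =
    y [:: push Phi u; push Psi v] W + y [:: push Psi u; push Phi v] W
    - Psi [:: Tagged A (y [:: u; v] c)] W.
Proof.
have DyQ := quadratic_bracket PsiA yQ.
rewrite P_exp_pair // (bracket_arrow_target PsiA _ yQ cW).
rewrite (multilinear0 [::] [::] _ _ PhiA.1.1) subr0.
rewrite !bracket_arrow_pair // (arrow_output_pair PsiA _ _ yQ).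
rewrite !(arrow_output_eq0 PsiA yQ) ?eqxx ?orbT // !subr0.
rewrite ?push_push // ?y_0l ?y_0r ?y_pushl ?y_pushr ?add0r ?addr0.
by rewrite -addrA addrC.
Qed.

(** Both factors are already pushed by [Psi], so a further push by [Phi] gives zero. *)
Lemma P_exp_bracket2_gt :
  P_exp Phi (bracket (bracket y Psi) Psi) [:: u; v] W =
    y [:: push Psi u; push Psi v] W *+ 2.
Proof.
have DyQ := quadratic_bracket PsiA yQ; have DDyQ := quadratic_bracket PsiA DyQ.
rewrite P_exp_pair // (bracket_arrow_target PsiA _ DyQ cW).
rewrite (multilinear0 [::] [::] _ _ PhiA.1.1) subr0 !bracket2_pair //.
rewrite ?push_push // ?y_0l ?y_0r ?y_pushl ?y_pushr ?mul0rn ?add0r ?addr0.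
by [].
Qed.

(** Expanding the bilinear [y] at [Phi u + Psi u] and [Phi v + Psi v] sorts the terms by order 0, 1
    and 2 in [Psi]; the output term has only orders 0 and 1. *)
Lemma P_exp_add_pair :
  P_exp (Phi + Psi) y [:: u; v] W =
    P_exp Phi y [:: u; v] W + P_exp Phi (bracket y Psi) [:: u; v] W
    + y [:: push Psi u; push Psi v] W.
Proof.
have yDl p q r S : y [:: Tagged A (p + q : A W); r] S =
    y [:: Tagged A p; r] S + y [:: Tagged A q; r] S.
  exact: (linearPD (yL [::] [:: r] S)).
have yDr p q r S : y [:: r; Tagged A (p + q : A W)] S =
    y [:: r; Tagged A p] S + y [:: r; Tagged A q] S.
  exact: (linearPD (yL [:: r] [::] S)).
have PPA := linear_arrow_add PhiA PsiA.
rewrite !P_exp_gt // P_exp_bracket_gt.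
rewrite {1 2}/push !cochainE yDl !yDr !opprD !addrA.
by rewrite [LHS](+%R.[ACl 1*5*2*3*6*4]).
Qed.

End Twist.

(** * Taylor expansion of [P_exp] in the arrow *)

Section MaurerCartanTerms.
Variables Phi Psi : cochain A.
Hypotheses (PhiA : linear_arrow Phi) (PsiA : linear_arrow Psi).
Hypothesis char_k : [pchar k] =i pred0.

(** This is exp [., Phi + Psi] = exp [., Phi] exp [., Psi] for commuting derivations, the second
    exponential stopping at order 2. By [P_exp_support] it is enough to compare values on pairs. *)
Lemma P_exp_addr y : gt_space y -> of_degree 1 y ->
  P_exp (Phi + Psi) y = P_exp Phi y + P_exp Phi (bracket y Psi)
                      + 2%:R^-1 *: P_exp Phi (bracket (bracket y Psi) Psi).
Proof.
move=> ygt y1; have yQ := quadratic_gt ygt y1.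
have DyQ := quadratic_bracket PsiA yQ; have DDyQ := quadratic_bracket PsiA DyQ.
have PPA := linear_arrow_add PhiA PsiA.
apply: cochainP => s S; rewrite !cochainE.
have [P0|[c [a [b [cW -> ->]]]]] := P_exp_support s S.
  by rewrite !P0 // scaler0 !addr0.
rewrite P_exp_add_pair // P_exp_bracket2_gt // -scaler_nat scalerA mulVf ?scale1r //.
by rewrite (pcharf0P k).1.
Qed.

Lemma P_exp0 : P_exp Phi 0 = 0.
Proof.
have := P_exp_add PhiA quadratic0 quadratic0; rewrite addr0 => P00.
by apply: (addrI (P_exp Phi 0)); rewrite addr0 -P00.
Qed.

End MaurerCartanTerms.

(** All entries have degree 0, so every Koszul sign is 1 and the [n.+2] positions of [x] contribute
    equally. The minus sign of the binary bracket comes from |x| = 1 before the shift. *)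
Lemma linf_bracket_diag M Phi x Psi n :
  linf_bracket M Phi (nseq n.+2 (0, (x, Psi))) =
    (if n is 0 then - bracket x x else 0,
     P_exp Phi (iter n.+1 (fun y => bracket y Psi) x) *+ n.+2
     + P_exp Phi (iter n.+2 (fun y => bracket y Psi) M)).
Proof.
rewrite /linf_bracket !map_nseq size_nseq.
rewrite (_ : nseq n.+2 _ = [:: (0, (x, Psi)), (0, (x, Psi)) & nseq n (0, (x, Psi))]) //.
congr (_, _ + _).
- by case: n => //=; rewrite /binary_gt add0r expr1z scaleN1r.
- rewrite (eq_bigr (fun=> P_exp Phi (iter n.+1 (fun y => bracket y Psi) x))).
    by rewrite sumr_const card_ord.
  move=> j _; rewrite !nth_nseq ltn_ord mul0r expr0z scale1r /derived_bracket.
  rewrite take_nseq 1?ltnW // drop_nseq -nseqD foldl_nseq.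
  (* Without position [j] there remain [j + (n.+2 - j.+1) = n.+1] arrows. *)
  by congr (P_exp Phi (iter _ _ _)); have := ltn_ord j; lia.
by rewrite /derived_bracket foldl_nseq.
Qed.

(** * Brackets of bilinear cochains and associators *)

Lemma bracket11E f g a b c S :
    quadratic f -> quadratic g ->
  bracket f g [:: a; b; c] S =
    circ 1 1 f g [:: a; b; c] S + circ 1 1 g f [:: a; b; c] S.
Proof.
move=> [[fL _] f1] [[gL _] g1].
by rewrite (bracketE _ fL gL f1 g1) // mul1n expr1 scaleN1r opprK.
Qed.

Lemma bracket_degree2_ext f g f' g' :
    quadratic f -> quadratic g -> quadratic f' -> quadratic g' ->
    (forall a b c S, bracket f g [:: a; b; c] S = bracket f' g' [:: a; b; c] S) ->
  bracket f g = bracket f' g'.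
Proof.
move=> [[fL _] f1] [[gL _] g1] [[f'L _] f'1] [[g'L _] g'1] fg.
apply: cochainP => s S; have [|sz] := eqVneq (size s) 3.
  by case: s => [|a [|b [|c []]]].
rewrite ((of_degreeP 2 _).1 (bracket_of_degree fL gL f1 g1)) //.
by rewrite ((of_degreeP 2 _).1 (bracket_of_degree f'L g'L f'1 g'1)).
Qed.

Lemma bracket11C f g : quadratic f -> quadratic g -> bracket f g = bracket g f.
Proof.
by move=> fQ gQ; apply: bracket_degree2_ext => // a b c S; rewrite !bracket11E // addrC.
Qed.

Lemma bracket11D f g h : quadratic f -> quadratic g -> quadratic h ->
  bracket f (g + h) = bracket f g + bracket f h.
Proof.
move=> fQ gQ hQ; have ghQ := quadratic_add gQ hQ.
have [[fL _] f1] := fQ; have [[gL _] g1] := gQ; have [[hL _] h1] := hQ.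
apply: cochainP => s S; rewrite cochainE; have [|sz] := eqVneq (size s) 3; last first.
  have f_deg2 x : quadratic x -> bracket f x s S = 0.
    by move=> [[xL _] x1]; apply: ((of_degreeP 2 _).1 (bracket_of_degree fL xL f1 x1)).
  by rewrite !f_deg2 // addr0.
case: s => [|a [|b [|c []]]] // _; rewrite !bracket11E // addrACA.
congr (_ + _); rewrite !circ11E -big_split; apply: eq_bigr => R _; rewrite !cochainE.
  have := linearPD (fL [::] [:: c] R S) (g [:: a; b] R) (h [:: a; b] R) => /= ->.
  have := linearPD (fL [:: a] [::] R S) (g [:: b; c] R) (h [:: b; c] R) => /= ->.
  by rewrite opprD addrACA.
by rewrite opprD [LHS]addrACA.
Qed.

(** For target [S], a cochain of [gt_space] accepts an inner product only in [A S], so the sum over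
    [R] collapses to the associator of [y]. *)
Lemma circ11_gtE y S (a b c : {d : vertex & A d}) : gt_space y ->
  circ 1 1 y y [:: a; b; c] S =
    y [:: Tagged A (y [:: a; b] S); c] S - y [:: a; Tagged A (y [:: b; c] S)] S.
Proof.
move=> ygt; rewrite circ11E (bigD1 S) //= big1 ?addr0 // => R RS.
rewrite (gt_pair_eq0 (b := c)) // ?(gt_pair_eq0 (a := a) (S := S)) ?subrr //=.
  by rewrite (negbTE RS) andbF.
by rewrite (negbTE RS).
Qed.

(** If [a] or [c] is outside [A S], one of the two terms has it as an outer input and the other has
    it in the inner product, which is then 0. If only [b] is outside, both inner products vanish. *)
Lemma circ11_gt_eq0 y (a b c : {d : vertex & A d}) S :
    gt_space y -> ~~ [&& tag a == S, tag b == S & tag c == S] ->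
  circ 1 1 y y [:: a; b; c] S = 0.
Proof.
move=> ygt abcS; rewrite circ11_gtE //.
have yE := gt_pair_eq0 ygt.
have y0l d q : y [:: Tagged A (0 : A d); q] S = 0.
  exact: (multilinear0 [::] [:: q] _ _ ygt.1).
have y0r d q : y [:: q; Tagged A (0 : A d)] S = 0.
  exact: (multilinear0 [:: q] [::] _ _ ygt.1).
have [aS|aS] := eqVneq (tag a) S; last first.
  by rewrite (yE a b) ?(negbTE aS) // y0l yE ?subr0 //= (negbTE aS).
have [cS|cS] := eqVneq (tag c) S; last first.
  by rewrite (yE b c) ?(negbTE cS) ?andbF // y0r yE ?subr0 //= (negbTE cS) andbF.
have bS : tag b != S by move: abcS; rewrite aS cS eqxx andbT.
by rewrite (yE a b) ?(yE b c) ?(negbTE bS) ?andbF // y0l y0r subr0.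
Qed.

End Cochains.

(** * The Maurer-Cartan equation *)

Lemma MC_linf (k : fieldType) (char_k : [pchar k] =i pred0)
    (A : vertex -> lmodType k) (M Phi M' Phi' : cochain A) :
    gt_space M -> of_degree 1 M -> gt_space M' -> of_degree 1 M' ->
    linear_arrow Phi -> linear_arrow Phi' ->
    bracket M M = 0 -> P_exp Phi M = 0 ->
  MC (L := linf M Phi) (M', Phi') <->
  bracket (M + M') (M + M') = 0 /\ P_exp (Phi + Phi') (M + M') = 0.
Proof.
move=> Mgt M1 M'gt M'1 PhiA Phi'A MM PM.
have MQ := quadratic_gt Mgt M1; have M'Q := quadratic_gt M'gt M'1.
have MM'Q := quadratic_add MQ M'Q.
have nat_neq0 n : n.+1%:R != 0 :> k by rewrite (pcharf0P k).1.
have PPA := linear_arrow_add PhiA Phi'A.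
pose L := linf M Phi; pose z : lb_space L := (M', Phi').
have MC_termE n : MC_term z n.+2 = (n.+2)`!%:R^-1 *:
    (if n is 0 then - bracket M' M' else 0,
     P_exp Phi (iter n.+1 (fun y => bracket y Phi') M') *+ n.+2
     + P_exp Phi (iter n.+2 (fun y => bracket y Phi') M)).
  exact: congr1 (linf_bracket_diag M Phi M' Phi' n).
(* In arity [n] the arrow is bracketed [n] times into [M] and [n - 1] times into [M']; from arity 4
   on both counts exceed 2. *)
have MC_term0 n : (3 < n)%N -> MC_term z n = 0.
  case: n => [|[|[|[|n]]]] // _; rewrite MC_termE !(iter_bracket_eq0 Phi'A) //.
  by rewrite (P_exp0 PhiA) mul0rn addr0 scaler0.
have MC_term1E : MC_term z 1 = (- bracket M M', P_exp Phi (M' + bracket M Phi')).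
  by rewrite /MC_term invr1 scale1r.
have MC_sum : \sum_(n \in [set n | (0 < n)%N]%classic) MC_term z n =
    (- (2%:R^-1 *: bracket (M + M') (M + M')), P_exp (Phi + Phi') (M + M')).
  rewrite (fsbigE [:: 1; 2; 3]%N) //=; last 2 first.
  - by move=> n /=; rewrite !inE => /or3P[]/eqP->.
  - by move=> [|[|[|[|n]]]] // _ _; apply: MC_term0.
  rewrite !big_cons big_nil !mem_set // addr0 MC_term1E !MC_termE.
  (* In arity 3 the term of [M] is already a triple bracket, that of [M'] only a double one. *)
  rewrite (iter_bracket_eq0 (n := 3) Phi'A MQ) // P_exp0 // addr0 /=.
  (* The three positions of [M'] turn 1/3! into the Taylor coefficient 1/2! of [P_exp_addr]. *)
  have third : 3`!%:R^-1 * 3%:R = 2%:R^-1 :> k.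
    by rewrite (_ : 3`! = 2 * 3)%N // natrM invfM mulfVK.
  have half2 (x : cochain A) : 2%:R^-1 *: (x *+ 2) = x.
    by rewrite -scaler_nat scalerA mulVf // scale1r.
  have DMQ := quadratic_bracket Phi'A MQ.
  transitivity (- bracket M M' + (2`!%:R^-1 *: - bracket M' M' + 3`!%:R^-1 *: 0),
    P_exp Phi (M' + bracket M Phi')
    + (2`!%:R^-1 *: (P_exp Phi (bracket M' Phi') *+ 2
                     + P_exp Phi (bracket (bracket M Phi') Phi'))
       + 3`!%:R^-1 *: (P_exp Phi (bracket (bracket M' Phi') Phi') *+ 3))) => //.
  congr (_, _).
    (* Additivity on the right and symmetry give 1/2 [M + M', M + M'] = [M, M'] + 1/2 [M', M'], once
       [MM] has removed [M, M]. *)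
    rewrite bracket11D // (bracket11C MM'Q MQ) (bracket11C MM'Q M'Q) !bracket11D //.
    rewrite MM add0r (bracket11C M'Q MQ) [in RHS]addrA -mulr2n scalerDr half2.
    by rewrite scaler0 addr0 scalerN -opprD.
  (* The expansion at [Phi + Phi'] has six Taylor terms; [PM] removes one and the other five form
     the Maurer-Cartan sum. *)
  rewrite !P_exp_add // !P_exp_addr // PM add0r scalerDr half2.
  rewrite -[X in _ + _ *: X]scaler_nat scalerA third !addrA.
  by rewrite [RHS](+%R.[ACl 3*1*4*2*5]).
split=> [[_ _]|[MM'0 P0]]; last split=> //.
- rewrite MC_sum => -[/eqP B0 ->]; split=> //.
  by move: B0; rewrite oppr_eq0 scaler_eq0 invr_eq0 (negbTE (nat_neq0 1%N)) => /eqP.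
(* Membership in [MC] also asks for finite support: nonzero terms have arity below 4. *)
- apply: (sub_finite_set _ (finite_II 4)) => n /= [_].
  by apply: contraNltn => n4; rewrite MC_term0.
- by rewrite MC_sum MM'0 P0 scaler0 oppr0.
Qed.

(** * From cochains back to diagrams of algebras *)

Section Diagram.
Variables (k : fieldType) (A : vertex -> lmodType k).
Variables (mu : A U -> A U -> A U) (nu : A V -> A V -> A V) (xi : A W -> A W -> A W).
Variables (phi : A U -> A W) (psi : A V -> A W).
Hypotheses (mu_bilin : bilinear_for *:%R *:%R mu)
  (nu_bilin : bilinear_for *:%R *:%R nu) (xi_bilin : bilinear_for *:%R *:%R xi)
  (phi_lin : linear phi) (psi_lin : linear psi).
Local Notation M := (mult_cochain mu nu xi).
Local Notation Phi := (map_cochain phi psi).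

Lemma mult_cochain_degree : of_degree 1 M.
Proof.
apply/of_degreeP => -[|[[] a] [|[[] b] [|c s]]] [] //.
Qed.

Lemma mult_cochain_gt : gt_space M.
Proof.
split.
  apply: multilinear_degree1; first exact: mult_cochain_degree.
    move=> [] [[] b] [] t u v /=; rewrite ?scaler0 ?addr0 //;
    [exact: mu_bilin.1|exact: nu_bilin.1|exact: xi_bilin.1].
  move=> [] [[] b] [] t u v /=; rewrite ?scaler0 ?addr0 //;
    [exact: mu_bilin.2|exact: nu_bilin.2|exact: xi_bilin.2].
move=> [|[[] a] [|[[] b] [|c s]]] [] //.
all: by rewrite /gt_summand /= ?eqxx.
Qed.

Lemma map_cochain_arrow : linear_arrow Phi.
Proof.
have Phi0 : of_degree 0 Phi by apply/of_degreeP => -[|[[] a] [|b s]] [].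
split=> //; split.
  apply: multilinear_degree0 => // -[] [] t u v /=; rewrite ?scaler0 ?addr0 //;
    [exact: phi_lin|exact: psi_lin].
move=> [|[[] a] [|b s]] [] //.
all: by rewrite /a_summand /= ?eqxx ?orbT.
Qed.

(** Half of [bracket M M] is the associator on each of the three algebras and vanishes on mixed
    triples; characteristic 0 permits the halving. *)
Lemma bracket_mult_cochain (char_k : [pchar k] =i pred0) :
  bracket M M = 0 <-> [/\ associative mu, associative nu & associative xi].
Proof.
have MQ := quadratic_gt mult_cochain_gt mult_cochain_degree.
split=> [B0|[muA nuA xiA]].
  have assoc S (a b c : A S) :
      M [:: Tagged A a; Tagged A (M [:: Tagged A b; Tagged A c] S)] S =
      M [:: Tagged A (M [:: Tagged A a; Tagged A b] S); Tagged A c] S.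
    have : bracket M M [:: Tagged A a; Tagged A b; Tagged A c] S = 0 by rewrite B0.
    rewrite bracket11E // -mulr2n (circ11_gtE _ _ _ _ mult_cochain_gt).
    rewrite -scaler_nat => /eqP.
    by rewrite scaler_eq0 (pcharf0P k).1 //= subr_eq0 => /eqP.
  by split=> a b c; apply: assoc.
apply: cochainP => s S; have [|sz] := eqVneq (size s) 3; last first.
  by apply: ((of_degreeP 2 _).1 (bracket_of_degree MQ.1.1 MQ.1.1 MQ.2 MQ.2)).
case: s => [|a [|b [|c []]]] // _; rewrite bracket11E //.
have [|abcS] := boolP [&& tag a == S, tag b == S & tag c == S]; last first.
  by rewrite (circ11_gt_eq0 mult_cochain_gt) // addr0.
case: a b c => [ta a] [tb b] [tc c] /= /and3P[/eqP aS /eqP bS /eqP cS].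
subst ta tb tc; rewrite (circ11_gtE _ _ _ _ mult_cochain_gt).
suff -> : M [:: Tagged A a; Tagged A (M [:: Tagged A b; Tagged A c] S)] S =
      M [:: Tagged A (M [:: Tagged A a; Tagged A b] S); Tagged A c] S.
  by rewrite subrr addr0.
by case: S a b c => a b c /=.
Qed.

Lemma P_exp_mult_cochain (char_k : [pchar k] =i pred0) :
  P_exp Phi M = 0 <->
  {morph phi : x y / mu x y >-> xi x y} /\ {morph psi : x y / nu x y >-> xi x y}.
Proof.
have MQ := quadratic_gt mult_cochain_gt mult_cochain_degree.
have PE c (a b : A c) : c != W -> P_exp Phi M [:: Tagged A a; Tagged A b] W =
    M [:: push Phi (Tagged A a); push Phi (Tagged A b)] W
    - Phi [:: Tagged A (M [:: Tagged A a; Tagged A b] c)] W.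
  by move=> cW; apply: P_exp_gt => //; [exact: mult_cochain_gt|
    exact: mult_cochain_degree|exact: map_cochain_arrow].
have UW : U != W by apply/eqP.
have VW : V != W by apply/eqP.
split=> [P0|[phiM psiM]].
  (* The assumption found is [UW] for [phi] and [VW] for [psi]. *)
  by split=> a b; have /eqP := PE _ a b ltac:(eassumption);
    rewrite P0 eq_sym subr_eq0 => /eqP/= ->.
apply: cochainP => s S.
have [P0|[c [a [b [cW -> ->]]]]] := P_exp_support s S.
  by rewrite P0 //; exact: map_cochain_arrow.
rewrite PE //; apply/eqP; rewrite subr_eq0; apply/eqP.
case: c a b cW => a b cW; [exact/esym/phiM|exact/esym/psiM|].
by rewrite eqxx in cW.
Qed.

Lemma algebra_diagramE (char_k : [pchar k] =i pred0) :
  is_algebra_diagram mu nu xi phi psi <-> bracket M M = 0 /\ P_exp Phi M = 0.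
Proof.
split=> [[[_ muA] [_ nuA] [_ xiA] [_ phiM] [_ psiM]]|].
  by split; [apply/bracket_mult_cochain|apply/P_exp_mult_cochain].
by case=> /(bracket_mult_cochain char_k)[? ? ?] /(P_exp_mult_cochain char_k)[? ?].
Qed.

End Diagram.

Theorem theorem4p7 (k : fieldType) (char_k : [pchar k] =i pred0)
    (A : vertex -> lmodType k)
    (mu : A U -> A U -> A U) (nu : A V -> A V -> A V) (xi : A W -> A W -> A W)
    (phi : A U -> A W) (psi : A V -> A W)
    (diag : is_algebra_diagram mu nu xi phi psi)
    (mu' : A U -> A U -> A U) (nu' : A V -> A V -> A V)
    (xi' : A W -> A W -> A W) (phi' : A U -> A W) (psi' : A V -> A W)
    (mu'_bilin : bilinear_for *:%R *:%R mu')
    (nu'_bilin : bilinear_for *:%R *:%R nu')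
    (xi'_bilin : bilinear_for *:%R *:%R xi')
    (phi'_lin : linear phi') (psi'_lin : linear psi') :
  is_algebra_diagram
    (fun a b => mu a b + mu' a b) (fun a b => nu a b + nu' a b)
    (fun a b => xi a b + xi' a b)
    (fun a => phi a + phi' a) (fun a => psi a + psi' a)
  <->
  MC (L := linf (mult_cochain mu nu xi) (map_cochain phi psi))
    (mult_cochain mu' nu' xi', map_cochain phi' psi').
Proof.
have [[mu_bilin _] [nu_bilin _] [xi_bilin _] [phi_lin _] [psi_lin _]] := diag.
have bilinD (B : lmodType k) (m m' : B -> B -> B) :
    bilinear_for *:%R *:%R m -> bilinear_for *:%R *:%R m' ->
    bilinear_for *:%R *:%R (fun a b => m a b + m' a b).
  move=> mB m'B; split=> c t a b /=.
    by rewrite mB.1 m'B.1 scalerDr addrACA.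
  by rewrite mB.2 m'B.2 scalerDr addrACA.
have linD (B C : lmodType k) (f f' : B -> C) :
    linear f -> linear f' -> linear (fun a => f a + f' a).
  by move=> fL f'L t a b /=; rewrite fL f'L scalerDr addrACA.
(* The original diagram supplies the two vanishing conditions at the base point that [MC_linf] asks
   for. *)
have [MM PM] :=
  (algebra_diagramE mu_bilin nu_bilin xi_bilin phi_lin psi_lin char_k).1 diag.
rewrite MC_linf //; try exact: mult_cochain_gt; try exact: mult_cochain_degree;
  try exact: map_cochain_arrow.
have -> : mult_cochain mu nu xi + mult_cochain mu' nu' xi' =
    mult_cochain (fun a b => mu a b + mu' a b) (fun a b => nu a b + nu' a b)
                 (fun a b => xi a b + xi' a b).
  apply: cochainP => -[|[[] a] [|[[] b] [|c s]]] []; rewrite cochainE //= ?addr0 //.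
have -> : map_cochain phi psi + map_cochain phi' psi' =
    map_cochain (fun a => phi a + phi' a) (fun a => psi a + psi' a).
  by apply: cochainP => -[|[[] a] [|b s]] []; rewrite cochainE //= addr0.
(* The same criterion, now for the deformed structures. *)
by apply: algebra_diagramE => //; do ?[exact: bilinD|exact: linD].
Qed.
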